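(* For every real number $c$ there exists a (closed) convex quadrangle $Q$ in the plane such that every self-coverability function $f$ of the family of all homothets of $Q$ satisfies $f(k)\ge ck$ for all integers $k\ge 1$.
   Context: A homothet of a planar set $Q$ is a set of the form $\lambda Q+v$ with $\lambda>0$ and $v\in\mathbb R^2$. A self-coverability function of a collection $\mathcal S$ of closed sets is a function $f$ from the non-negative integers to the non-negative integers such that for any $S\in\mathcal S$ and any finite point set $P\subset S$ with $|P|=k$ there exists a subcollection $\mathcal S'\subset\mathcal S$ with $|\mathcal S'|\le f(k)$ such that $\bigcup\mathcal S'=S$ and no point of $P$ is in the interior of any $S'\in\mathcal S'$. *)

(* Defs.v *)
From HB Require Import structures.
From mathcomp Require Import all_boot all_order all_algebra.
From mathcomp Require Import all_classical all_reals all_analysis.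
Set Implicit Arguments.
Unset Strict Implicit.
Unset Printing Implicit Defensive.
Import Order.TTheory GRing.Theory Num.Theory.
Import numFieldNormedType.Exports.

Local Open Scope classical_set_scope.
Local Open Scope ring_scope.

Definition convex_hull (R : realType) (X : set 'rV[R]_2) : set 'rV[R]_2 :=
  smallest (@convex_set R 'rV[R]_2) X.

(* The four points are in convex position, so they are pairwise distinct and no
   three of them are collinear. *)
Definition convex_quadrangle (R : realType) (Q : set 'rV[R]_2) : Prop :=
  exists v : 'I_4 -> 'rV[R]_2,
    (forall i, ~ convex_hull [set v j | j in [set j | j != i]] (v i)) /\
    Q = convex_hull (range v).

Definition homothets (R : realType) (Q : set 'rV[R]_2) : set (set 'rV[R]_2) :=
  [set S | exists lam : R, exists v : 'rV[R]_2,
    0 < lam /\ S = [set lam *: q + v | q in Q]].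

Definition self_coverability_function (R : realType)
    (SS : set (set 'rV[R]_2)) (f : nat -> nat) : Prop :=
  forall (S : set 'rV[R]_2) (k : nat) (P : set 'rV[R]_2),
    SS S -> P `<=` S -> (P #= `I_k)%card ->
    exists SS' : set (set 'rV[R]_2),
      [/\ SS' `<=` SS,
          (SS' #<= `I_(f k))%card,
          \bigcup_(T in SS') T = S &
          forall p T, P p -> SS' T -> ~ interior T p].

(* Main.v *)
Require Import Defs.
From mathcomp Require Import all_boot all_order all_algebra.
From mathcomp Require Import all_classical all_reals all_analysis.
From mathcomp Require Import ring lra zify.
Import Order.TTheory GRing.Theory Num.Theory.
Import numFieldNormedType.Exports.
Local Open Scope classical_set_scope.
Local Open Scope ring_scope.

(* Q is the trapezoid 0 <= y <= 1, 0 <= x <= 1 + m y, whose right side is very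
   slanted.  Inside a large copy S of Q, a homothet T that meets the bottom side
   y = 0 of S at (t, 0) has its own bottom side there; if T is taller than 1,
   then its interior contains every point (p, 1) with t < p < t + m.  So a
   forbidden point (p, 1) forces every homothet covering a point of the segment
   ]p - m, p[ of the bottom side to have size, hence bottom side, at most 1,
   and about m / 2 homothets are needed to cover points at mutual distance 2
   of this segment.  Placing k forbidden points at distance m + 1 from
   each other multiplies this number by k. *)

Definition pt {R : realType} (x y : R) : 'rV[R]_2 :=
  \row_(i < 2) (if i == 0 then x else y).

Definition lin {R : realType} (a b : R) (q : 'rV[R]_2) : R :=
  a * q 0 0 + b * q 0 1.

Definition trapezoid {R : realType} (m : R) : set 'rV[R]_2 :=
  [set q | [/\ 0 <= q 0 1, q 0 1 <= 1, 0 <= q 0 0 & q 0 0 <= 1 + m * q 0 1]].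

Lemma pt_x (R : realType) (x y : R) : pt x y 0 0 = x.
Proof. by rewrite mxE. Qed.

Lemma pt_y (R : realType) (x y : R) : pt x y 0 1 = y.
Proof. by rewrite mxE. Qed.

Lemma pt_eta (R : realType) (q : 'rV[R]_2) : q = pt (q 0 0) (q 0 1).
Proof.
apply/rowP => i; rewrite mxE; case: eqVneq => [-> //|i0].
congr (q _ _); apply/val_inj.
by case: i i0 => [[|[|]]].
Qed.

Lemma lin_continuous (R : realType) (a b : R) : continuous (lin a b).
Proof.
have c (i : 'I_2) : continuous (fun q : 'rV[R]_2 => q 0 i).
  exact: coord_continuous.
move=> q; exact: (continuousD
  (continuousM (@cst_continuous _ _ a q) (c 0 q))
  (continuousM (@cst_continuous _ _ b q) (c 1 q))).
Qed.

Lemma closed_halfplane (R : realType) (a b d : R) :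
  closed [set q | lin a b q <= d].
Proof.
apply: (closed_comp (f := lin a b) (D := [set z | z <= d])).
- by move=> q _; exact: lin_continuous.
- exact: closed_le.
Qed.

Lemma open_halfplane (R : realType) (a b d : R) :
  open [set q | lin a b q < d].
Proof.
apply: (open_comp (f := lin a b) (D := [set z | z < d])).
- by move=> q _; exact: lin_continuous.
- exact: open_lt.
Qed.

(** A closed half-plane is convex, so minimality of the hull applies to it. Every upper bound on a
    hull below comes from this. *)
Lemma convex_hull_halfplane {R : realType} (X : set 'rV[R]_2) (a b d : R) :
  (forall q, X q -> lin a b q <= d) ->
  forall q, convex_hull X q -> lin a b q <= d.
Proof.
move=> XH; apply: (@smallest_sub _ _ X [set q | lin a b q <= d]) => //.
move=> x y t; rewrite !inE/= => hx hy.
have -> : lin a b (conv t x y) =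
    t%:num * lin a b x + (1 - t%:num) * lin a b y.
  by rewrite /lin !mxE/= /unstable.onem; ring.
have : 0 <= t%:num :> R by [].
have : t%:num <= 1 :> R by [].
move: (t%:num) => s s1 s0; nra.
Qed.

Lemma convex_hull_conv {R : realType} {X : set 'rV[R]_2} {x y : 'rV[R]_2}
    (t : R) :
  convex_hull X x -> convex_hull X y -> 0 <= t <= 1 ->
  convex_hull X (t *: x + (1 - t) *: y).
Proof.
move=> hx hy /andP[t0 t1] A [cA XA].
have := cA x y (Itv01 t0 t1); rewrite !inE; apply; [exact: hx|exact: hy].
Qed.

Definition trapezoid_vertex {R : realType} (m : R) (i : 'I_4) : 'rV[R]_2 :=
  match val i with
  | 0 => pt 0 0
  | 1 => pt 1 0
  | 2 => pt (1 + m) 1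
  | _ => pt 0 1
  end%N.

Lemma trapezoid_vertex_free {R : realType} {m : R} (m0 : 0 <= m) (i : 'I_4) :
  ~ convex_hull [set trapezoid_vertex m j | j in [set j | j != i]]
      (trapezoid_vertex m i).
Proof.
suff [a [b [d [hj]]]] : exists a b d,
    (forall j, j != i -> lin a b (trapezoid_vertex m j) <= d) /\
    d < lin a b (trapezoid_vertex m i).
  rewrite ltNge => /negP hi /(convex_hull_halfplane _ a b d) H; apply: hi.
  by apply: H => q [j ji <-]; exact: hj.
(* In each case the separating line is the diagonal through the two neighbours of vertex [i]. *)
case: i => [[|[|[|[|//]]]]] ilt.
- exists (-1), (-1), (-1); split=> [[[|[|[|[|//]]]]] jlt //= _|];
    by rewrite /lin /trapezoid_vertex/= ?pt_x ?pt_y; lra.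
- exists 1, (- (1 + m)), 0; split=> [[[|[|[|[|//]]]]] jlt //= _|];
    by rewrite /lin /trapezoid_vertex/= ?pt_x ?pt_y; lra.
- exists 1, 1, 1; split=> [[[|[|[|[|//]]]]] jlt //= _|];
    by rewrite /lin /trapezoid_vertex/= ?pt_x ?pt_y; lra.
- exists (-1), (1 + m), 0; split=> [[[|[|[|[|//]]]]] jlt //= _|];
    by rewrite /lin /trapezoid_vertex/= ?pt_x ?pt_y; lra.
Qed.

Lemma trapezoid_hull {R : realType} {m : R} (m0 : 0 <= m) :
  trapezoid m = convex_hull (range (trapezoid_vertex m)).
Proof.
apply/seteqP; split=> q /=.
  case=> y0 y1 x0 xle.
  have vert (i : 'I_4) :
      convex_hull (range (trapezoid_vertex m)) (trapezoid_vertex m i).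
    by apply: sub_gen_smallest; exists i.
  have yi : 0 <= q 0 1 <= 1 by rewrite y0.
  (* [hr] and [hl] give the points of the right and left sides at the height of [q]; [q] lies on the
     horizontal segment between them. *)
  have hr :=
    convex_hull_conv _ (vert (@Ordinal 4 2 isT)) (vert (@Ordinal 4 1 isT)) yi.
  have hl :=
    convex_hull_conv _ (vert (@Ordinal 4 3 isT)) (vert (@Ordinal 4 0 isT)) yi.
  have w0 : 0 < 1 + m * q 0 1 by nra.
  have ti : 0 <= q 0 0 / (1 + m * q 0 1) <= 1.
    by rewrite divr_ge0 ?(ltW w0)//= ler_pdivrMr// mul1r.
  have := convex_hull_conv _ hr hl ti.
  congr (convex_hull _ _).
  rewrite [RHS]pt_eta [LHS]pt_eta !mxE/=; congr pt; field; lra.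
move=> hq.
(* The four premises bound the linear form at the four vertices. *)
have H a b d : 0 <= d -> a <= d -> a * (1 + m) + b <= d -> b <= d ->
    a * q 0 0 + b * q 0 1 <= d.
  move=> d0 ad bd cd; apply: (convex_hull_halfplane _ _ _ _ _ _ hq).
  move=> _ [i _ <-]; rewrite /lin; case: i => [[|[|[|[|//]]]]] ilt;
    by rewrite /trapezoid_vertex/= !pt_x !pt_y; lra.
have h1 : 0 * q 0 0 + (-1) * q 0 1 <= 0 by apply: H; lra.
have h2 : 0 * q 0 0 + 1 * q 0 1 <= 1 by apply: H; lra.
have h3 : (-1) * q 0 0 + 0 * q 0 1 <= 0 by apply: H; lra.
have h4 : 1 * q 0 0 + (- m) * q 0 1 <= 1 by apply: H; lra.
by split; lra.
Qed.

Lemma trapezoid_quadrangle (R : realType) (m : R) (m0 : 0 <= m) :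
  convex_quadrangle (trapezoid m).
Proof.
exists (trapezoid_vertex m); split; [exact: (trapezoid_vertex_free m0)|].
exact: (trapezoid_hull m0).
Qed.

Lemma closed_trapezoid (R : realType) (m : R) : closed (trapezoid m).
Proof.
have -> : trapezoid m =
    ([set q | lin 0 (-1) q <= 0] `&` [set q | lin 0 1 q <= 1]) `&`
    ([set q | lin (-1) 0 q <= 0] `&` [set q | lin 1 (-m) q <= 1]).
  apply/seteqP; split=> q; rewrite /lin /=.
    by case=> *; do !split; lra.
  by case=> -[? ?] [? ?]; split; lra.
by do 2?apply: closedI; exact: closed_halfplane.
Qed.

Lemma homothet_trapezoidP {R : realType} {m lam : R} {v : 'rV[R]_2}
    (lam0 : 0 < lam) (q : 'rV[R]_2) :
  [set lam *: u + v | u in trapezoid m] q <->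
  [/\ 0 <= q 0 1 - v 0 1, q 0 1 - v 0 1 <= lam, 0 <= q 0 0 - v 0 0 &
      q 0 0 - v 0 0 <= lam + m * (q 0 1 - v 0 1)].
Proof.
split=> [[u [y0 y1 x0 xle] <-]|[y0 y1 x0 xle]].
  by rewrite !mxE; split; nra.
exists (lam^-1 *: (q - v)); last first.
  by rewrite scalerA divff ?gt_eqF// scale1r subrK.
rewrite /trapezoid/= !mxE; split.
- by rewrite mulr_ge0// invr_ge0 ltW.
- by rewrite mulrC ler_pdivrMr// mul1r.
- by rewrite mulr_ge0// invr_ge0 ltW.
- rewrite -(ler_pM2l lam0) (mulrDr lam 1) mulr1 (mulrCA lam m).
  by rewrite !mulVKf ?gt_eqF.
Qed.

(** The strict versions of the inequalities of the homothet cut out an open subset of it. *)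
Lemma interior_homothet_trapezoid {R : realType} {m lam : R} {v : 'rV[R]_2}
    (lam0 : 0 < lam) (q : 'rV[R]_2) :
  0 < q 0 1 - v 0 1 -> q 0 1 - v 0 1 < lam -> 0 < q 0 0 - v 0 0 ->
  q 0 0 - v 0 0 < lam + m * (q 0 1 - v 0 1) ->
  interior [set lam *: u + v | u in trapezoid m] q.
Proof.
move=> y0 y1 x0 xlt.
pose U := ([set q | lin 0 (-1) q < - v 0 1] `&`
           [set q | lin 0 1 q < lam + v 0 1]) `&`
    ([set q | lin (-1) 0 q < - v 0 0] `&`
     [set q | lin 1 (-m) q < lam + v 0 0 - m * v 0 1]).
have oU : open U by do 2?apply: openI; exact: open_halfplane.
apply: (@interiorS _ U).
  move=> u; rewrite /U /lin/= => -[[? ?] [? ?]].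
  by apply/(homothet_trapezoidP lam0); split; lra.
by apply: open_nbhs_nbhs; split=> //; rewrite /U /lin/=; do !split; lra.
Qed.

Theorem theorem9 (R : realType) (c : R) :
  exists Q : set 'rV[R]_2,
    [/\ convex_quadrangle Q,
        closed Q &
        forall f : nat -> nat, self_coverability_function (homothets Q) f ->
          forall k : nat, (1 <= k)%N -> c * k%:R <= (f k)%:R].
Proof.
pose n := Num.bound c; have cn : c <= n%:R by exact/ltW/unstable.ltr_bound.
pose m : R := n.*2.+1%:R; have m0 : 0 <= m by exact: ler0n.
exists (trapezoid m); split.
- exact: trapezoid_quadrangle.
- exact: closed_trapezoid.
move=> f fP k k0.
suff nkf : (n * k <= f k)%N.
  apply: (@le_trans _ _ (n * k)%:R); last by rewrite ler_nat.
  by rewrite natrM ler_wpM2r.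
(* The [p i] are the positive multiples of [2 * (n + 1) = m + 1]. The [t j] run through the other
   positive even integers, [n] in each gap: the summand [j %/ n] skips the [p i]. The side [L]
   equals [p (k - 1)]. *)
pose p (i : nat) : R := (i.+1 * n.+1).*2%:R.
pose t (j : nat) : R := (j + j %/ n).+1.*2%:R.
pose L : R := (k * n.+1).*2%:R.
have L0 : 0 < L by rewrite ltr0n double_gt0 muln_gt0 k0.
pose S : set 'rV[R]_2 := [set L *: u + 0 | u in trapezoid m].
(* As [m] is nonnegative, [S] contains the square of side [L]. *)
have SP (q : 'rV[R]_2) : 0 <= q 0 1 <= L -> 0 <= q 0 0 <= L -> S q.
  move=> /andP[? ?] /andP[? ?]; apply/(homothet_trapezoidP L0).
  by rewrite !mxE !subr0; split=> //; nra.
pose P : set 'rV[R]_2 := [set pt (p i) 1 | i in `I_k].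
have PS : P `<=` S.
  move=> _ [i /= ik <-]; apply: SP; rewrite ?pt_x ?pt_y ?ler01 ?ler0n/=.
    by rewrite ler1n double_gt0 muln_gt0 k0.
  by rewrite ler_nat leq_double leq_mul2r ik orbT.
have Pk : (P #= `I_k)%card.
  apply: inj_card_eq => i j _ _ /(congr1 (fun q : 'rV[R]_2 => q 0 0)).
  rewrite !pt_x => /eqP; rewrite eqr_nat => /eqP/double_inj/eqP.
  by rewrite eqn_pmul2r// => /eqP[].
have [SS' [SS'h SS'f SS'U SS'P]] : exists SS' : set (set 'rV[R]_2),
    [/\ SS' `<=` homothets (trapezoid m), (SS' #<= `I_(f k))%card,
        \bigcup_(T in SS') T = S &
        forall p T, P p -> SS' T -> ~ interior T p].
  by apply: fP => //; exists L, 0.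
(* The bound on [j] sits under the existential so that [choice] yields a total function; [set0] is a
   dummy value. *)
have tcov j : exists T, (j < n * k)%N -> SS' T /\ T (pt (t j) 0).
  have [jnk|] := boolP (j < n * k)%N; last by exists set0.
  have : S (pt (t j) 0).
    apply: SP; rewrite ?pt_x ?pt_y; first by rewrite lexx ltW.
    rewrite ler0n/= ler_nat leq_double.
    have : (j %/ n < k)%N by rewrite ltn_divLR; lia.
    by lia.
  by rewrite -SS'U => -[T TSS' Tt]; exists T.
have [T Tcov] := choice tcov.
(* [v] and [lam] are the left end and the length of the bottom side of [T j]. *)
have narrow j : (j < n * k)%N -> exists lam v, lam <= 1 /\
    (forall x, T j (pt x 0) -> 0 <= x - v <= lam).
  move=> jnk; have [TS Tt] := Tcov _ jnk.
  have [lam [v [lam0 TE]]] := SS'h _ TS; exists lam, (v 0 0).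
  (* The corner [v] lies in [T j], hence in [S], so its height is at least 0; it is at most 0
     because [T j] contains a point of height 0. *)
  have v10 : v 0 1 = 0.
    have : S v.
      rewrite -SS'U; exists (T j) => //; rewrite TE.
      by apply/(homothet_trapezoidP lam0); rewrite !subrr; split=> //; nra.
    move=> /(homothet_trapezoidP L0) [v1 _ _ _].
    move: Tt; rewrite TE => /(homothet_trapezoidP lam0) [].
    by rewrite pt_y; move: v1; rewrite mxE; lra.
  have Twidth x : T j (pt x 0) -> 0 <= x - v 0 0 <= lam.
    rewrite TE => /(homothet_trapezoidP lam0) [].
    by rewrite pt_x pt_y v10 => _ _ -> /=; lra.
  split=> //; rewrite leNgt; apply/negP => lam1.
  have n0 : (0 < n)%N by case: (n) jnk.
  have ik : (j %/ n < k)%N by rewrite ltn_divLR// mulnC.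
  have rn : (j %% n < n)%N by rewrite ltn_mod.
  (* With [r = j %% n], the distance from [t j] to the next forbidden abscissa is [2 * (n - r)],
     between 2 and [m - 1]. So if [lam] exceeded 1, that forbidden point would be interior to
     [T j]. *)
  have tp : t j + 1 <= p (j %/ n)%N.
    rewrite /t /p natr1 ler_nat; move: rn (div.divn_eq j n); nia.
  have pm : p (j %/ n)%N + 1 <= t j + m.
    rewrite /t /p /m natr1 -natrD ler_nat; move: rn (div.divn_eq j n); nia.
  have /andP[tv0 tv1] := Twidth _ Tt.
  apply: (SS'P (pt (p (j %/ n)%N) 1) (T j)) => //; first by exists (j %/ n)%N.
  rewrite TE; apply: (interior_homothet_trapezoid lam0);
    rewrite ?pt_x ?pt_y ?v10; lra.
(* Distinct [t j] are at least 2 apart, too far for one bottom side of length at most 1. *)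
have Tinj : {in `I_(n * k) &, injective T}.
  suff H i j : (i < j)%N -> (j < n * k)%N -> T i <> T j.
    move=> i j; rewrite !inE/= => ik jk Tij.
    by case: (ltngtP i j) => // /H; [move/(_ jk)|move/(_ ik)]; rewrite Tij.
  move=> ij jnk Tij.
  have ink : (i < n * k)%N by exact: ltn_trans jnk.
  have [lam [v [lam1 Tw]]] := narrow _ jnk.
  have /andP[_ tj] := Tw _ (Tcov _ jnk).2.
  have /andP[ti _] : 0 <= t i - v <= lam.
    by apply: Tw; rewrite -Tij; exact: (Tcov _ ink).2.
  have : t i + 2 <= t j.
    rewrite /t -natrD ler_nat.
    have := leq_div2r n (ltnW ij); lia.
  lra.
rewrite -card_le_II; apply: card_le_trans SS'f.
apply: (@card_le_trans _ _ _ (T @` `I_(n * k))).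
  by move: (inj_card_eq Tinj); rewrite card_eq_le => /andP[].
by apply: subset_card_le => _ [j /= jnk <-]; exact: (Tcov _ jnk).1.
Qed.
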